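(* Let $X$ be a subshift on a finite alphabet whose word complexity function $p$ satisfies $\liminf_{q\to\infty}\frac{p(q)}{q}<\infty$, and let $\mu$ be an ergodic shift-invariant Borel probability measure on $X$. Then $\mu$ is partially rigid; hence, if $\mu$ is nonatomic, $\mu$ is not strongly mixing.
   Context: A subshift on a finite set $\mathcal{A}$ is a closed (in the product topology), shift-invariant subset $X\subset\mathcal{A}^{\mathbb{Z}}$. Its language $\mathcal{L}(X)$ is the set of finite words occurring as (contiguous) subwords of elements of $X$, and $p(q)=|\mathcal{L}(X)\cap\mathcal{A}^q|$. Let $T$ denote the shift. For $\delta>0$, $\mu$ is $\delta$-partially rigid if there is a sequence of positive integers $t_n\to\infty$ such that $\liminf_{n\to\infty}\mu(T^{t_n}A\cap A)\ge\delta\,\mu(A)$ for every measurable set $A$; $\mu$ is partially rigid if it is $\delta$-partially rigid for some $\delta>0$. $\mu$ is strongly mixing if $\mu(T^nA\cap B)\to\mu(A)\mu(B)$ for all measurable $A,B$. *)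

(* Defs.v *)
From HB Require Import structures.
From mathcomp Require Import all_boot all_order all_algebra.
From mathcomp Require Import all_classical all_reals all_analysis.
Set Implicit Arguments.
Unset Strict Implicit.
Unset Printing Implicit Defensive.
Import Order.TTheory GRing.Theory Num.Theory.
Import numFieldNormedType.Exports.
Local Open Scope classical_set_scope.
Local Open Scope ring_scope.

Definition fullshift (A : finType) : topologicalType :=
  prod_topology (fun _ : int => discrete_topology A).

Definition shift (A : finType) (x : fullshift A) : fullshift A :=
  fun i => x (i + 1).

(* Nonemptiness is needed for the pointed structure underlying measurable
   types; it is automatic as soon as X carries a probability measure. *)
Record subshift (A : finType) := Subshift {
  points :> set (fullshift A) ;
  subshift_closed : closed points ;
  subshift_invariant : @shift A @` points = points ;
  subshift_nonempty : points !=set0 }.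

Definition word (A : finType) (x : fullshift A) (i : int) (q : nat) : seq A :=
  mkseq (fun k => x (i + k%:Z) : A) q.

Definition language (A : finType) (X : set (fullshift A)) : set (seq A) :=
  [set w | exists x i q, X x /\ w = word x i q].

Definition complexity (A : finType) (X : set (fullshift A)) (q : nat) : nat :=
  #|[pred w : q.-tuple A | (w : seq A) \in language X]|.

(* The points of X as a type, with the topology induced by the full shift. *)
Definition subshift_space (A : finType) (X : subshift A) : Type :=
  set_type (points X).

HB.instance Definition _ (A : finType) (X : subshift A) :=
  Topological.copy (subshift_space X) (set_type (points X)).

HB.instance Definition _ (A : finType) (X : subshift A) :=
  isPointed.Build (subshift_space X)
    (exist _ (projT1 (cid (subshift_nonempty X)))
             (mem_set (projT2 (cid (subshift_nonempty X))))).

Definition borel_subshift (A : finType) (X : subshift A) :=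
  g_sigma_algebraType (@open (subshift_space X)).

Lemma shift_in (A : finType) (X : subshift A) (x : set_type (points X)) :
  shift (\val x) \in points X.
Proof.
apply: mem_set; have := imageP (@shift A) (set_valP x).
by rewrite subshift_invariant.
Qed.

Definition subshift_map (A : finType) (X : subshift A)
    (x : borel_subshift X) : borel_subshift X :=
  exist _ (shift (\val (x : set_type (points X)))) (shift_in x).

(* T ^ n E is the forward image.  It is measurable for the subshift map, which
   is a homeomorphism of X because shift @` X = X. *)
Section dynamics.
Context {d : measure_display} {S : measurableType d} {R : realType}.
Variables (mu : probability S R) (T : S -> S).

Definition invariant_measure :=
  forall E, measurable E -> mu (T @^-1` E) = mu E.

Definition ergodic :=
  forall E, measurable E -> T @^-1` E = E -> mu E = 0%E \/ mu E = 1%E.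

Definition delta_partially_rigid (delta : R) :=
  exists t : nat -> nat,
    [/\ forall n, (0 < t n)%N,
        t n @[n --> \oo] --> \oo &
        forall E, measurable E ->
          (delta%:E * mu E <=
             limn_einf (fun n => mu ((iter (t n) T @` E) `&` E)))%E].

Definition partially_rigid :=
  exists2 delta : R, 0 < delta & delta_partially_rigid delta.

Definition strongly_mixing :=
  forall E F, measurable E -> measurable F ->
    mu ((iter n T @` E) `&` F) @[n --> \oo] --> (mu E * mu F)%E.

Definition atom (E : set S) :=
  [/\ measurable E, (0 < mu E)%E &
      forall F, measurable F -> F `<=` E -> mu F = 0%E \/ mu F = mu E].

Definition nonatomic := forall E, ~ atom E.

End dynamics.

(* Main.v *)
Require Import Defs.
From HB Require Import structures.
From mathcomp Require Import all_boot all_order all_algebra.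
From mathcomp Require Import all_classical all_reals all_analysis.
From mathcomp Require Import zify lra.
Set Implicit Arguments.
Unset Strict Implicit.
Unset Printing Implicit Defensive.
Import Order.TTheory GRing.Theory Num.Theory.
Import numFieldNormedType.Exports.
Local Open Scope classical_set_scope.
Local Open Scope ring_scope.

(** Let [p] be the complexity of [X].

    Since [p q <= C * q] for arbitrarily large [q], there are arbitrarily large
    [r] at which both the ratio of [p r] to [r] and the increment from [p r] to
    [p r.+1] are bounded by [K = 3 * C] ([low_complexity_length]).  At such an
    [r] the Rauzy graph of the words of length [r] has boundedly many branching
    vertices and boundedly many unbranched paths between them, each of length
    at most a multiple of [r].  So every sequence that is not eventually
    periodic returns to one of its words of length [r] after one of boundedly
    many times, and does so within a time proportional to [r]
    ([bounded_return_times]).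

    By pigeonhole, a single time [t] works for a set of points of probability
    bounded below.  Moving along the orbit through the middle of the repeated
    word produces a set [D], still of probability at least some [dl]
    independent of [r], whose points repeat after [t] steps on a window of
    length proportional to [r] around the origin ([recurrence_at_scale]).
    As a union of long orbit segments, [D] is almost invariant, and ergodicity
    forces the sets [D] to become equidistributed: in the limit they meet any
    [E] in probability at least [dl * prob mu E]
    ([almost_invariant_equidistributed]).  On the other hand, if [E] depends on
    finitely many coordinates, the points of [D `&` E] return to [E] after [t]
    steps.  Sets of this kind approximate all Borel sets
    ([window_approximation]), and partial rigidity follows.

    The return times tend to infinity unless the points of some period have
    positive probability.  In that case they have full probability by
    ergodicity, and the multiples of the period are rigidity times
    ([periodic_partially_rigid]).

    The equidistribution of almost invariant sets rests on the following form of
    the uniqueness of the invariant measure below an ergodic one: an invariant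
    additive function of sets that is dominated by a multiple of an ergodic
    probability is proportional to it.  The reason is that the negative part of
    a Hahn decomposition can be made invariant ([invariant_dominated_ge0]).

    Finally, mixing along the rigidity times would bound the probability of
    every nonnull set from below, which a nonatomic measure excludes
    ([partially_rigid_not_mixing]). *)

(** * Right special words *)

Section Words.
Local Open Scope nat_scope.
Context (A : finType) (U : set (nat -> A)).

Definition prefix_word q (u : nat -> A) : q.-tuple A := [tuple u i | i < q].

Lemma prefix_wordP q u v :
  prefix_word q u = prefix_word q v <-> (forall i, i < q -> u i = v i).
Proof.
split=> [e i iq|e].
  by have := congr1 (fun w => tnth w (Ordinal iq)) e; rewrite !tnth_mktuple.
by apply: eq_from_tnth => i; rewrite !tnth_mktuple; apply: e.
Qed.

Definition lang q : {set q.-tuple A} :=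
  [set w | `[< exists2 u, U u & prefix_word q u = w >]].

Lemma langP q w : reflect (exists2 u, U u & prefix_word q u = w) (w \in lang q).
Proof. by rewrite inE; apply: asboolP. Qed.

Lemma prefix_lang q u : U u -> prefix_word q u \in lang q.
Proof. by move=> Uu; apply/langP; exists u. Qed.

(** The branching vertices of the Rauzy graph, whose vertices are the words of
    length [r] of the language and whose edges are those of length [r.+1]. *)
Definition right_special r : {set r.-tuple A} :=
  [set w | `[< exists u v, [/\ U u, U v, prefix_word r u = w,
     prefix_word r v = w & u r <> v r] >]].

Lemma right_special_lang r w : w \in right_special r -> w \in lang r.
Proof. by rewrite inE => /asboolP[u [v [Uu _ <- _ _]]]; apply: prefix_lang. Qed.

Lemma not_right_special r u v : U u -> U v ->
  prefix_word r u \notin right_special r ->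
  prefix_word r u = prefix_word r v -> u r = v r.
Proof.
rewrite inE => Uu Uv /asboolP nrs e; apply: contrapT => uv; apply: nrs.
by exists u, v.
Qed.

Definition word_prefix r (w : r.+1.-tuple A) : r.-tuple A :=
  [tuple tnth w (widen_ord (leqnSn r) i) | i < r].

Lemma word_prefixE r u : word_prefix (prefix_word r.+1 u) = prefix_word r u.
Proof. by apply: eq_from_tnth => i; rewrite !tnth_mktuple. Qed.

Lemma word_prefix_lang r w : w \in lang r.+1 -> word_prefix w \in lang r.
Proof. by case/langP => u Uu <-; rewrite word_prefixE prefix_lang. Qed.

(** The edges that leave the branching vertices. *)
Definition special_edges r : {set r.+1.-tuple A} :=
  [set w in lang r.+1 | word_prefix w \in right_special r].

Definition extensions r (w : r.-tuple A) : {set r.+1.-tuple A} :=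
  [set v in lang r.+1 | word_prefix v == w].

Lemma in_special_edges r w : (w \in special_edges r) =
  (w \in lang r.+1) && (word_prefix w \in right_special r).
Proof. exact: finset.in_set. Qed.

Lemma in_extensions r (w : r.-tuple A) v : (v \in extensions w) =
  (v \in lang r.+1) && (word_prefix v == w).
Proof. exact: finset.in_set. Qed.

Lemma extensions_gt0 r w : w \in lang r -> 0 < #|extensions w|.
Proof.
case/langP => u Uu <-; apply/card_gt0P; exists (prefix_word r.+1 u).
by rewrite in_extensions prefix_lang // word_prefixE eqxx.
Qed.

Lemma extensions_gt1 r w : w \in right_special r -> 1 < #|extensions w|.
Proof.
rewrite inE => /asboolP[u [v [Uu Uv <- vu uv]]].
apply/card_gt1P; exists (prefix_word r.+1 u), (prefix_word r.+1 v).
rewrite !in_extensions !prefix_lang // !word_prefixE vu eqxx; split=> //.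
by apply/eqP => /prefix_wordP /(_ r (ltnSn r)).
Qed.

Lemma card_lang_succ r :
  #|lang r.+1| = \sum_(w in lang r) #|extensions w|.
Proof.
rewrite -sum1_card (partition_big (@word_prefix r) (mem (lang r))) /=; last first.
  by move=> w /word_prefix_lang.
apply: eq_bigr => w _; rewrite -sum1_card; apply: eq_bigl => v.
by rewrite in_extensions.
Qed.

Lemma card_special_edges r :
  #|special_edges r| = \sum_(w in right_special r) #|extensions w|.
Proof.
rewrite -sum1_card (partition_big (@word_prefix r) (mem (right_special r))) /=.
  apply: eq_bigr => w rsw; rewrite -sum1_card; apply: eq_bigl => v.
  rewrite in_extensions in_special_edges.
  by case: eqP => [->|]; rewrite ?rsw ?andbT ?andbF.
by move=> w; rewrite in_special_edges => /andP[].
Qed.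

(** Every word of the language extends to the right, and every right special
    one does so in at least two ways. *)
Lemma card_right_special r : #|lang r| + #|right_special r| <= #|lang r.+1|.
Proof.
rewrite card_lang_succ -sum1_card -sum1_card.
have rsl : right_special r \subset lang r.
  by apply/fintype.subsetP => w; apply: right_special_lang.
rewrite [X in _ + X](_ : _ = \sum_(w in lang r) (w \in right_special r)).
  rewrite -big_split /=; apply: leq_sum => w wl.
  case: (boolP (w \in right_special r)) => [/extensions_gt1|_] //.
  exact: extensions_gt0.
rewrite [RHS](bigID (mem (right_special r))) /= [X in _ + X]big1; last first.
  by move=> w /andP[_ /negPf->].
rewrite addn0; apply: eq_big => [w|w ->] //.
by case: (boolP (w \in right_special r)) => [/right_special_lang->|]; rewrite ?andbF.
Qed.

Lemma card_special_edges_le r :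
  #|special_edges r| + #|lang r| <= #|lang r.+1| + #|right_special r|.
Proof.
have rsl : right_special r \subset lang r.
  by apply/fintype.subsetP => w; apply: right_special_lang.
rewrite card_lang_succ (big_setID (right_special r)) /=.
rewrite (finset.setIidPr rsl) -card_special_edges -addnA leq_add2l.
rewrite -(cardsID (right_special r) (lang r)) (finset.setIidPr rsl) addnC leq_add2r.
rewrite -sum1_card; apply: leq_sum => w; rewrite inE => /andP[_].
exact: extensions_gt0.
Qed.

(** The increment of the complexity is the surplus of edges over vertices, and
    each vertex has an outgoing edge.  So [K] bounds the number of branching
    vertices, and their outgoing edges exceed them by at most [K]. *)
Lemma card_special_edges_bound r K : #|lang r.+1| <= #|lang r| + K ->
  #|special_edges r| <= 2 * K.
Proof. by have := card_special_edges_le r; have := card_right_special r; lia. Qed.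

End Words.

(** * Return times *)

Section Returns.
Local Open Scope nat_scope.
Context (A : finType) (U : set (nat -> A)).
Hypothesis drop_closed : forall u i, U u -> U (fun k => u (i + k)).

Local Notation drop u i := (fun k => u (i + k)).
Local Notation special r u i :=
  (prefix_word r (drop u i) \in right_special U r).

(** A word that is not right special forces its next letter, so a path of the
    Rauzy graph is forced by its first edge until it reaches a branching
    vertex. *)
Lemma deterministic_extension r u v h : U u -> U v ->
  prefix_word r.+1 u = prefix_word r.+1 v ->
  (forall k, 0 < k < h -> ~~ special r u k) ->
  forall i, i < r + h -> u i = v i.
Proof.
move=> Uu Uv uv nrs; elim/ltn_ind => i IH ih.
have [ir|ri] := ltnP i r.+1; first by move/prefix_wordP: uv; apply.
have -> : i = (i - r) + r by lia.
apply: (not_right_special (U := U) (u := drop u (i - r)) (v := drop v (i - r))).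
- exact: drop_closed.
- exact: drop_closed.
- by apply: nrs; lia.
- by apply/prefix_wordP => j jr; apply: IH; lia.
Qed.

Definition next_special r u h :=
  [/\ 0 < h, special r u h & forall k, 0 < k < h -> ~~ special r u k].

Lemma next_special_word r u v h : U u -> U v ->
  prefix_word r.+1 u = prefix_word r.+1 v ->
  next_special r u h -> next_special r v h.
Proof.
move=> Uu Uv uv [h0 sh nsh].
have e k : k <= h -> prefix_word r (drop u k) = prefix_word r (drop v k).
  move=> kh; apply/prefix_wordP => i ir.
  by apply: (deterministic_extension Uu Uv uv nsh); lia.
split=> //; first by rewrite -e.
by move=> k kh; rewrite -e; [apply: nsh|lia].
Qed.

Lemma next_special_uniq r u h h' :
  next_special r u h -> next_special r u h' -> h = h'.
Proof.
move=> [h0 sh nsh] [h'0 sh' nsh'].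
case: (ltngtP h h') => // hh'.
- by have := nsh' h; rewrite h0 hh' sh => /(_ isT).
- by have := nsh h'; rewrite h'0 hh' sh' => /(_ isT).
Qed.

(** The length of the unbranched path that starts with the edge [e].  It is well
    defined by [next_special_word]; the default value concerns the edges from
    which no branching vertex is reached. *)
Definition edge_length r (e : r.+1.-tuple A) : nat :=
  xget 0 [set h | exists u, [/\ U u, prefix_word r.+1 u = e & next_special r u h]].

Lemma edge_lengthE r u h : U u -> next_special r u h ->
  edge_length (prefix_word r.+1 u) = h.
Proof.
move=> Uu nuh; rewrite /edge_length; case: xgetP => [h' _|/(_ h)[]];
  last by exists u.
move=> [v [Uv uv nvh]]; apply: next_special_uniq nuh.
exact: next_special_word nvh.
Qed.

Definition eventually_periodic (u : nat -> A) :=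
  exists a t, 0 < t /\ forall k, u (a + k) = u (a + k + t).

Lemma eventually_periodic_drop u i :
  eventually_periodic (drop u i) -> eventually_periodic u.
Proof.
move=> [a [t [t0 e]]]; exists (i + a), t; split=> // k.
by have := e k; rewrite !addnA.
Qed.

(** If the path avoids the branching vertices for one step more than there are
    vertices, it visits some vertex twice.  It then goes round a cycle with no
    exit for ever, and the sequence is eventually periodic. *)
Lemma next_special_exists r u : U u -> ~ eventually_periodic u ->
  exists2 h, next_special r u h & h <= #|lang U r|.+1.
Proof.
move=> Uu nep; set N := #|lang U r|.
have [h /and3P[h0 hN sh]] : exists h, [&& 0 < h, h <= N.+1 & special r u h].
  apply: contrapT => nex; apply: nep.
  have ns k : 0 < k <= N.+1 -> ~~ special r u k.
    by move=> /andP[k0 kN]; apply/negP => sk; apply: nex; exists k; rewrite k0 kN sk.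
  pose f (k : 'I_N.+1) := prefix_word r (drop u k.+1).
  have /injectivePn[a0 [b0 ab fab]] : ~~ injectiveb f.
    apply/negP => /injectiveP fi.
    have := card_imset (mem 'I_N.+1) fi; rewrite card_ord => fE.
    suff : #|[set f x | x in 'I_N.+1]%SET| <= N by rewrite fE ltnn.
    apply: subset_leq_card; apply/fintype.subsetP => w /imsetP[k _ ->].
    exact/prefix_lang/drop_closed.
  wlog ltab : a0 b0 ab fab / a0 < b0.
    move=> H; have /orP[ltH|ltH] : (a0 < b0) || (b0 < a0)
      by rewrite -neq_ltn (inj_eq val_inj).
    - exact: (H a0 b0).
    - by apply: (H b0 a0) => //; rewrite eq_sym.
  set a := a0.+1; set b := b0.+1.
  have H i : (prefix_word r (drop u (a + i)) = prefix_word r (drop u (b + i)))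
             /\ ~~ special r u (a + i).
    elim/ltn_ind: i => i IH.
    have nsi : ~~ special r u (a + i).
      have [iab|abi] := ltnP i (b - a).
        apply: ns; have := ltn_ord b0; rewrite /a /b in iab *; lia.
      have -> : a + i = b + (i - (b - a)) by rewrite /a /b in abi *; lia.
      have [|<- //] := IH (i - (b - a)).
      by rewrite /a /b in abi *; lia.
    split=> //.
    case: i IH nsi => [_ _|i IH nsi]; first by rewrite !addn0.
    have [e nse] := IH i (ltnSn i).
    have er : u (a + i + r) = u (b + i + r).
      by apply: (not_right_special (U := U) (drop_closed (a + i) Uu)
         (drop_closed (b + i) Uu)).
    apply/prefix_wordP => j jr; have [jr'|jr'] := ltnP j.+1 r.
      by have /prefix_wordP/(_ j.+1 jr') := e; rewrite !addnS !addSn.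
    have jE : r = j.+1 by apply/eqP; rewrite eqn_leq jr' jr.
    by move: er; rewrite jE !addnS !addSn.
  exists (a + r), (b - a); split; first by rewrite /a /b; lia.
  move=> k.
  have [e nse] := H k; have := not_right_special (drop_closed (a + k) Uu)
    (drop_closed (b + k) Uu) nse e.
  by rewrite addnAC => ->; congr u; rewrite /a /b; lia.
have exh : exists h, (0 < h) && special r u h by exists h; rewrite h0.
exists (ex_minn exh); case: ex_minnP => m /andP[m0 sm] mmin.
  split=> // k /andP[k0 km]; apply/negP => sk.
  by have := mmin k; rewrite k0 sk => /(_ isT); lia.
by apply: leq_trans hN; apply: mmin; rewrite h0.
Qed.

(** When [0] is in [s], sums of fewer than [m] entries occur as well. *)
Fixpoint sums_of (s : seq nat) m : seq nat :=
  if m is m'.+1 then [seq a + b | a <- s, b <- sums_of s m'] else [:: 0].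

Lemma size_sums_of s m : size (sums_of s m) = size s ^ m.
Proof. by elim: m => //= m IH; rewrite size_allpairs IH expnS. Qed.

Lemma mem_sums_of s m (f : nat -> nat) : (forall c, f c \in s) ->
  \sum_(c < m) f c \in sums_of s m.
Proof.
move=> fs; elim: m f fs => [|m IH] f fs; first by rewrite big_ord0 inE.
rewrite big_ord_recl /=; apply/allpairsP.
by exists (f 0, \sum_(c < m) f c.+1); split=> //=; apply: (IH (fun c => f c.+1)).
Qed.

(** A path runs through branching vertices, which it leaves by one of at most
    [2 * K] edges.  Among [2 * K + 1] consecutive departures two use the same
    edge, and the time between them is a sum of at most [2 * K] lengths of
    unbranched paths.  There are at most [2 * K] such lengths, so the number of
    possible return times is bounded in terms of [K] alone, for every [r]. *)
Theorem bounded_return_times r K : #|lang U r.+1| <= #|lang U r| + K ->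
  exists s : seq nat, [/\ size s <= (2 * K).+1 ^ (2 * K).+1,
    forall t, t \in s -> 0 < t &
    forall u, U u -> eventually_periodic u \/
      exists2 t, t \in s & exists2 j, j <= (2 * K).+1 * #|lang U r|.+1 &
        forall k, k < r -> u (j + k) = u (j + k + t)].
Proof.
move=> HK; set m := (2 * K).+1; set N := #|lang U r|.
have cE := card_special_edges_bound HK.
(* The extra length 0 pads the sums of fewer than m lengths. *)
pose hs := 0 :: [seq edge_length e | e <- enum (special_edges U r)].
have shs : size hs <= m by rewrite /= size_map -cardE.
exists [seq t <- sums_of hs m | 0 < t]; split.
- rewrite size_filter (leq_trans (count_size _ _)) // size_sums_of.
  by rewrite leq_exp2r.
- by move=> t; rewrite mem_filter => /andP[].
move=> u Uu; have [ep|nep] := pselect (eventually_periodic u); [by left|right].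
have nepd i : ~ eventually_periodic (drop u i).
  by move=> /eventually_periodic_drop.
pose len i := edge_length (prefix_word r.+1 (drop u i)).
have lenP i : next_special r (drop u i) (len i) /\ len i <= N.+1.
  have [h nh hN] := next_special_exists r (drop_closed i Uu) (nepd i).
  by rewrite /len (edge_lengthE (drop_closed i Uu) nh).
(* The successive visits to right special words. *)
pose v := fix v k := if k is k'.+1 then v k' + len (v k') else len 0.
have sv k : special r u (v k).
  case: k => [|k] /=; first by have [[]] := lenP 0.
  have [[_ + _] _] := lenP (v k).
  have -> // : drop (drop u (v k)) (len (v k)) = drop u (v k + len (v k)).
  by apply/funext => j; rewrite addnA.
have vle k : v k <= k.+1 * N.+1.
  elim: k => [|k IH] /=; first by rewrite mul1n; have [] := lenP 0.
  by have [_ H] := lenP (v k); rewrite mulSn addnC leq_add.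
have lenm k : len (v k) \in [seq edge_length e | e <- enum (special_edges U r)].
  apply: map_f; rewrite mem_enum in_special_edges prefix_lang /=;
    last exact: drop_closed.
  by rewrite word_prefixE sv.
have vsum a d : v (a + d) = v a + \sum_(c < d) len (v (a + c)).
  elim: d => [|d IH]; first by rewrite big_ord0 !addn0.
  by rewrite addnS big_ord_recr /= addnA -IH.
pose f (k : 'I_m) := prefix_word r.+1 (drop u (v k)).
have /injectivePn[a [b ab fab]] : ~~ injectiveb f.
  apply/negP => /injectiveP fi.
  have := card_imset (mem 'I_m) fi; rewrite card_ord => fE.
  suff : #|[set f x | x in 'I_m]%SET| < m by rewrite fE ltnn.
  apply: leq_trans cE; apply: subset_leq_card.
  apply/fintype.subsetP => w /imsetP[k _ ->].
  rewrite in_special_edges prefix_lang /=; last exact: drop_closed.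
  by rewrite word_prefixE sv.
wlog ltab : a b ab fab / a < b.
  move=> H; have /orP[ltH|ltH] : (a < b) || (b < a)
    by rewrite -neq_ltn (inj_eq val_inj).
  - exact: (H a b).
  - by apply: (H b a) => //; rewrite eq_sym.
pose t := \sum_(c < b - a) len (v (a + c)).
have vb : v b = v a + t by rewrite -vsum subnKC // ltnW.
exists t.
  rewrite mem_filter; apply/andP; split.
    rewrite /t; have -> : b - a = (b - a).-1.+1 by lia.
    rewrite big_ord_recl addn_gt0 addn0.
    by have [[-> _ _] _] := lenP (v a).
  pose g c := if c < b - a then len (v (a + c)) else 0.
  have -> : t = \sum_(c < m) g c.
    rewrite /t (big_ord_widen m (fun c => len (v (a + c)))); last first.
      by have := ltn_ord b; lia.
    by rewrite big_mkcond.
  apply: mem_sums_of => c; rewrite /g; case: ifP => _; rewrite in_cons ?eqxx //.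
  by rewrite lenm orbT.
exists (v a); first by rewrite (leq_trans (vle a)) // leq_mul2r ltn_ord orbT.
move=> k kr; have /prefix_wordP/(_ k) := fab; rewrite vb => -> //; last lia.
by congr u; lia.
Qed.

Lemma leq_card_lang q : #|lang U q| <= #|lang U q.+1|.
Proof. by apply: leq_trans (card_right_special U q); apply: leq_addr. Qed.

(** If all the increments of the complexity between [q./2] and [q] exceeded
    [3 * C], the complexity at [q] would exceed [C * q].  The length of a small
    increment found there is at least [q./2], which also gives the last bound. *)
Lemma low_complexity_length C n : 
  (exists2 q, n.*2.+2 <= q & #|lang U q| <= C * q) ->
  exists r, [/\ n <= r, #|lang U r.+1| <= #|lang U r| + 3 * C &
    #|lang U r| <= 3 * C * r].
Proof.
move=> [q nq pq]; apply: contrapT => nr.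
have mono a b : a <= b -> #|lang U a| <= #|lang U b|.
  move/subnK <-; elim: (b - a) => // k IH.
  exact: leq_trans IH (leq_card_lang _).
have step d : d <= q - q./2 ->
    d * (3 * C).+1 + #|lang U q./2| <= #|lang U (q./2 + d)|.
  elim: d => [|d IH] dq; first by rewrite addn0.
  have [H|H] := leqP #|lang U (q./2 + d).+1| (#|lang U (q./2 + d)| + 3 * C).
    exfalso; apply: nr; exists (q./2 + d); split=> //; first lia.
    rewrite (leq_trans (mono _ q _)) //; first lia.
    rewrite (leq_trans pq) // (mulnC 3) -mulnA leq_mul2l.
    by apply/orP; right; lia.
  by rewrite addnS; have := IH (ltnW dq); lia.
have := step (q - q./2) (leqnn _); rewrite subnKC; last lia.
move=> H; have {}H := leq_trans (leq_trans (leq_addr _ _) H) pq.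
have qq : q <= 2 * (q - q./2) by lia.
nia.
Qed.

End Returns.

(** * Probabilities and dominated charges *)

Lemma bigcup_partial_unions {S : Type} (F : nat -> set S) :
  \bigcup_n F n = \bigcup_n \big[setU/set0]_(i < n) F i.
Proof.
apply/seteqP; split=> x [n _].
  by move=> Fnx; exists n.+1 => //; rewrite -bigcup_mkord; exists n => /=.
by rewrite -bigcup_mkord => -[i _ Fix]; exists i.
Qed.

Section RealProbability.
Context {d} {S : measurableType d} {R : realType} (mu : probability S R).

(** Real-valued, so that the arithmetic of probabilities is that of an ordered
    field. *)
Definition prob (E : set S) : R := fine (mu E).

Lemma probE E : measurable E -> mu E = (prob E)%:E.
Proof. by move=> mE; rewrite fineK // fin_num_measure. Qed.

Lemma prob_ge0 E : 0 <= prob E.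
Proof. by rewrite fine_ge0 // measure_ge0. Qed.

Lemma probT : prob [set: S] = 1.
Proof. by rewrite /prob probability_setT. Qed.

Lemma prob0 : prob set0 = 0.
Proof. by rewrite /prob measure0. Qed.

Lemma probU A B : measurable A -> measurable B -> A `&` B = set0 ->
  prob (A `|` B) = prob A + prob B.
Proof.
move=> mA mB AB; apply: EFin_inj; rewrite EFinD -!probE //.
  by rewrite measureU.
exact: measurableU.
Qed.

Lemma prob_setD A B : measurable A -> measurable B ->
  prob A = prob (A `\` B) + prob (A `&` B).
Proof.
move=> mA mB; apply: EFin_inj; rewrite EFinD -!probE //.
- exact: measureDI.
- exact: measurableI.
- exact: measurableD.
Qed.

Lemma prob_le A B : measurable A -> measurable B -> A `<=` B ->
  prob A <= prob B.
Proof.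
by move=> mA mB AB; rewrite -lee_fin -!probE // le_measure ?inE.
Qed.

Lemma prob_le1 A : measurable A -> prob A <= 1.
Proof. by move=> mA; rewrite -probT; apply: prob_le. Qed.

Lemma probU_le A B : measurable A -> measurable B ->
  prob (A `|` B) <= prob A + prob B.
Proof.
move=> mA mB; rewrite -lee_fin EFinD -!probE ?measureU2 //.
exact: measurableU.
Qed.

Lemma prob_le_add A B C : measurable A -> measurable B -> measurable C ->
  C `<=` A `|` B -> prob C <= prob A + prob B.
Proof.
move=> mA mB mC CAB; apply: le_trans (probU_le mA mB).
by apply: prob_le => //; exact: measurableU.
Qed.

Lemma prob_setC A : measurable A -> prob (~` A) = 1 - prob A.
Proof.
move=> mA; have := prob_setD measurableT mA.
by rewrite setTD setTI probT => ->; rewrite addrK.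
Qed.

Lemma prob_nondecreasing_cvg (F : nat -> set S) :
  (forall n, measurable (F n)) -> nondecreasing_seq F ->
  prob (F n) @[n --> \oo] --> prob (\bigcup_n F n).
Proof.
move=> mF ndF; apply: fine_cvg; rewrite -probE; last exact: bigcup_measurable.
by apply: nondecreasing_cvg_mu => //; exact: bigcup_measurable.
Qed.

Lemma prob_nonincreasing_cvg (F : nat -> set S) :
  (forall n, measurable (F n)) -> nonincreasing_seq F ->
  prob (F n) @[n --> \oo] --> prob (\bigcap_n F n).
Proof.
move=> mF niF; have mI : measurable (\bigcap_n F n) by exact: bigcapT_measurable.
apply: fine_cvg; rewrite -probE //.
by apply: nonincreasing_cvg_mu => //; rewrite ltey_eq fin_num_measure. 
Qed.

End RealProbability.

(** A finitely additive [sg] dominated by a multiple of a probability inherits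
    its continuity along monotone sequences; in particular it is a charge. *)
Section InvariantCharge.
Context {d} {S : measurableType d} {R : realType} (mu : probability S R).
Context (sg : set S -> R) (C : R).
Hypothesis sgU : forall A B, measurable A -> measurable B -> A `&` B = set0 ->
  sg (A `|` B) = sg A + sg B.
Hypothesis sg_le : forall A, measurable A -> `|sg A| <= C * prob mu A.

Lemma dominated0 : sg set0 = 0.
Proof.
by apply/eqP; rewrite -normr_le0; have := sg_le measurable0; rewrite prob0 mulr0.
Qed.

Lemma dominated_setD A B : measurable A -> measurable B ->
  sg A = sg (A `\` B) + sg (A `&` B).
Proof.
move=> mA mB; rewrite -sgU.
- by rewrite -setDDr setDv setD0.
- exact: measurableD.
- exact: measurableI.
- by rewrite setDE setIACA setICl setI0.
Qed.

Lemma dominated_lipschitz A B : measurable A -> measurable B -> A `<=` B ->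
  `|sg B - sg A| <= C * (prob mu B - prob mu A).
Proof.
move=> mA mB AB.
rewrite (dominated_setD mB mA) (prob_setD mu mB mA) (setIidr AB) !addrK.
exact/sg_le/measurableD.
Qed.

Lemma dominated_cvg (F : nat -> set S) E : measurable E ->
  (forall n, measurable (F n)) ->
  (forall n, F n `<=` E) \/ (forall n, E `<=` F n) ->
  prob mu (F n) @[n --> \oo] --> prob mu E -> sg (F n) @[n --> \oo] --> sg E.
Proof.
move=> mE mF FE /cvgrPdist_le cv; apply/cvgrPdist_le => e e0.
have C1 : 0 < `|C| + 1 by rewrite ltr_wpDl.
have := cv (e / (`|C| + 1)) (divr_gt0 e0 C1); apply: filterS => n.
rewrite ler_pdivlMr // => H; apply: le_trans H.
have HC (x : R) : C * x <= `|x| * (`|C| + 1).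
  apply: (le_trans (ler_norm _)); rewrite normrM mulrC ler_wpM2l //.
  by rewrite lerDl.
case: FE => FE.
- by apply: le_trans (HC _); apply: dominated_lipschitz.
- by rewrite distrC [X in X * _]distrC; apply: le_trans (HC _);
    apply: dominated_lipschitz.
Qed.

Let charge_fun (A : set S) : \bar R := (sg A)%:E.

Let charge_fun0 : charge_fun set0 = 0%E.
Proof. by rewrite /charge_fun dominated0. Qed.

Let charge_fun_fin A : measurable A -> charge_fun A \is a fin_num.
Proof. by []. Qed.

Let charge_fun_sigma : semi_sigma_additive charge_fun.
Proof.
move=> F mF tF mUF.
pose G n := \big[setU/set0]_(i < n) F i.
have mG n : measurable (G n) by exact: bigsetU_measurable.
have sgG n : sg (G n) = \sum_(0 <= i < n) sg (F i).
  elim: n => [|n IH]; first by rewrite /G big_ord0 big_geq // dominated0.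
  have GF : G n `&` F n = set0.
    apply/seteqP; split=> x // [].
    rewrite /G -bigcup_mkord => -[i /= iltn Fix] Fnx.
    have iE : i = n by apply: tF => //; exists x.
    by rewrite iE ltnn in iltn.
  by rewrite big_nat_recr //= -IH -sgU // /G big_ord_recr.
rewrite (_ : (fun n => _) = (fun n => (sg (G n))%:E)); last first.
  by apply/funext => n; rewrite sumEFin sgG.
apply: cvg_EFin; first exact: nearW.
rewrite [X in X --> _](_ : _ = sg (G n) @[n --> \oo]) //.
apply: dominated_cvg => //.
  by left=> n; rewrite /G -bigcup_mkord => x [i _ Fix]; exists i.
rewrite bigcup_partial_unions; apply: prob_nondecreasing_cvg => //.
by move=> m n mn; apply/subsetPset; exact: subset_bigsetU.
Qed.

HB.instance Definition _ := isCharge.Build _ S R charge_fun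
  charge_fun0 charge_fun_fin charge_fun_sigma.

(** The negative part of the Hahn decomposition minimizes the charge. *)
Lemma dominated_minimizer : exists2 N, measurable N &
  forall A, measurable A -> sg N <= sg A.
Proof.
have [P [N [[mP posP] [mN negN] PN _]]] := Hahn_decomposition charge_fun.
exists N => // A mA.
rewrite (dominated_setD mA mN) (dominated_setD mN mA) setIC lerD2r.
apply: (@le_trans _ _ 0).
  by rewrite -lee_fin; apply: negN; [exact: measurableD|exact: subDsetl].
rewrite -lee_fin; apply: posP; first exact: measurableD.
by move=> x [_ nNx]; have : (P `|` N) x by [rewrite PN]; case.
Qed.

End InvariantCharge.

(** * Equidistribution of almost invariant sets *)

Section InvariantDominated.
Context {d} {S : measurableType d} {R : realType} (mu : probability S R).
Context (T : S -> S) (mT : measurable_fun setT T).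
Hypotheses (muT : invariant_measure mu T) (ergT : ergodic mu T).

Lemma measurable_preimage E : measurable E -> measurable (T @^-1` E).
Proof. by move=> mE; rewrite -[X in measurable X]setTI; apply: mT. Qed.

Lemma measurable_iter_preimage n E :
  measurable E -> measurable (iter n T @^-1` E).
Proof.
elim: n E => // n IH E mE.
rewrite (_ : _ @^-1` E = iter n T @^-1` (T @^-1` E)) //.
by apply: IH; exact: measurable_preimage.
Qed.

Lemma prob_preimage E : measurable E -> prob mu (T @^-1` E) = prob mu E.
Proof. by move=> mE; rewrite /prob muT. Qed.

Lemma prob_iter_preimage n E :
  measurable E -> prob mu (iter n T @^-1` E) = prob mu E.
Proof.
elim: n E => // n IH E mE.
rewrite (_ : _ @^-1` E = iter n T @^-1` (T @^-1` E)) //.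
by rewrite IH ?prob_preimage //; exact: measurable_preimage.
Qed.

Lemma prob_ergodic E : measurable E -> T @^-1` E = E ->
  prob mu E = 0 \/ prob mu E = 1.
Proof.
by move=> mE TE; have [|] := ergT mE TE; rewrite /prob => ->; [left|right].
Qed.

Context (sg : set S -> R) (C : R).
Hypothesis sgU : forall A B, measurable A -> measurable B -> A `&` B = set0 ->
  sg (A `|` B) = sg A + sg B.
Hypothesis sg_le : forall A, measurable A -> `|sg A| <= C * prob mu A.
Hypothesis sg_preimage : forall A, measurable A -> sg (T @^-1` A) = sg A.
Hypothesis sgT : sg setT = 0.

(** Sets of minimal charge are stable under unions and monotone limits, and under
    preimages by invariance.  So if [N] is one of them, the set of the points
    that visit [N] infinitely often is another; it is invariant, hence null or
    of full measure, and in both cases its charge is zero. *)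
Lemma invariant_dominated_ge0 A : measurable A -> 0 <= sg A.
Proof.
have [N mN minN] := dominated_minimizer sgU sg_le.
pose minimizer B := measurable B /\ sg B = sg N.
have minU B1 B2 : minimizer B1 -> minimizer B2 -> minimizer (B1 `|` B2).
  move=> [mB1 e1] [mB2 e2].
  have mU : measurable (B1 `|` B2) by exact: measurableU.
  split=> //; apply/eqP; rewrite eq_le minN // andbT.
  have -> : B1 `|` B2 = B1 `|` (B2 `\` B1) by rewrite setDE setUIr setUv setIT.
  rewrite sgU //; last 2 first.
  - exact: measurableD.
  - by rewrite setDE setICA setICr setI0.
  have := dominated_setD sgU mB2 mB1; have := minN _ (measurableI _ _ mB2 mB1).
  lra.
have min_pre n B : minimizer B -> minimizer (iter n T @^-1` B).
  elim: n B => // n IH B [mB eB].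
  rewrite (_ : _ @^-1` B = iter n T @^-1` (T @^-1` B)) //; apply: IH.
  by split; [exact: measurable_preimage|rewrite sg_preimage].
have min_lim (F : nat -> set S) E : measurable E -> (forall n, minimizer (F n)) ->
    (forall n, F n `<=` E) \/ (forall n, E `<=` F n) ->
    prob mu (F n) @[n --> \oo] --> prob mu E -> minimizer E.
  move=> mE minF FE cF; split=> //.
  have := dominated_cvg sgU sg_le mE (fun n => (minF n).1) FE cF.
  rewrite (_ : (fun n => _) = fun=> sg N); last first.
    by apply/funext => n; have [] := minF n.
  by move=> /(cvg_lim (@Rhausdorff R)) <-; rewrite lim_cst.
pose W k n := \big[setU/set0]_(i < n.+1) (iter (k + i) T @^-1` N).
have WE k n : W k n = \bigcup_(i in `I_n.+1) (iter (k + i) T @^-1` N).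
  by rewrite /W -(bigcup_mkord _ (fun i => iter (k + i) T @^-1` N)).
have minW k n : minimizer (W k n).
  elim: n => [|n IH]; rewrite /W.
    by rewrite big_ord_recl big_ord0 setU0; exact: min_pre.
  by rewrite big_ord_recr; apply: minU => //; exact: min_pre.
pose V k := \bigcup_n W k n.
have VE k x : V k x <-> exists i, N (iter (k + i) T x).
  split=> [[n _]|[i Ni]]; first by rewrite WE => -[i _ Ni]; exists i.
  by exists i => //; rewrite WE; exists i => /=.
have mV k : measurable (V k) by apply: bigcup_measurable => n _; exact: (minW k n).1.
have minV k : minimizer (V k).
  apply: (min_lim (W k)) => //; first by left=> n x Wx; exists n.
  apply: prob_nondecreasing_cvg; first by move=> n; exact: (minW k n).1.
  move=> m n mn; apply/subsetPset => x; rewrite !WE => -[i /= im Ni].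
  by exists i => //=; apply: leq_trans im _.
(* The points whose orbit meets N infinitely often. *)
pose L := \bigcap_k V k.
have mL : measurable L by exact: bigcapT_measurable.
have [_ sgL] : minimizer L.
  apply: (min_lim V) => //; first by right=> n x; apply.
  apply: prob_nonincreasing_cvg => // m n mn.
  apply/subsetPset => x /VE[i Ni]; apply/VE; exists (n - m + i)%N.
  by rewrite addnA subnKC.
have TL : T @^-1` L = L.
  apply/seteqP; split=> x Lx k _; apply/VE.
    have /VE[i Ni] := Lx k I; exists i.+1.
    by rewrite addnS iterSr.
  have /VE[i Ni] := Lx k.+1 I; exists i.
  by rewrite -iterSr -addSn.
have sgN : sg N = 0.
  rewrite -sgL; have [L0|L1] := prob_ergodic mL TL.
    have := sg_le mL; rewrite L0 mulr0 normr_le0 => /eqP //.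
  have := dominated_lipschitz sgU sg_le mL measurableT (@subsetT _ _).
  by rewrite L1 probT subrr mulr0 normr_le0 sgT sub0r oppr_eq0 => /eqP.
by move=> mA; rewrite -sgN; exact: minN.
Qed.

End InvariantDominated.

Section AlmostInvariant.
Context {d} {S : measurableType d} {R : realType} (mu : probability S R).
Context (T : S -> S) (mT : measurable_fun setT T).
Hypotheses (muT : invariant_measure mu T) (ergT : ergodic mu T).

Lemma ultra_bounded_cvg (F : set_system nat) (u : nat -> R) :
  UltraFilter F -> (forall n, 0 <= u n <= 1) -> exists l : R, u n @[n --> F] --> l.
Proof.
move=> FU u01.
have PF : ProperFilter (fmap u F) by apply: fmap_proper_filter.
have [|l [_ cl]] := @segment_compact R 0 1 (fmap u F) _.
  by apply: (@filterE _ F) => n /=; rewrite in_itv /= u01.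
exists l => V Vl.
have [//|H] := in_ultra_setVsetC (u @^-1` V) FU.
have [y [/= Hy Vy]] := cl (~` V) V H Vl.
by case: Hy.
Qed.

(** Ergodicity makes every weak limit of almost invariant sets constant.  If the
    bound failed along infinitely many [n], an ultrafilter of such indices would
    give an additive, invariant limit [nu A] of the [prob mu (D n `&` A)], with
    [nu] dominated by [mu].  Then [invariant_dominated_ge0], applied to the
    difference of [nu] and [c *: mu] with [c] the total mass of [nu], yields
    [nu E >= c * prob mu E], where [c >= dl]: a contradiction. *)
Theorem almost_invariant_equidistributed (D : nat -> set S) (dl : R) E :
  (forall n, measurable (D n)) -> measurable E ->
  (forall n, dl <= prob mu (D n)) ->
  prob mu (T @^-1` D n `\` D n) @[n --> \oo] --> (0 : R) ->
  forall e, 0 < e -> \forall n \near \oo,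
    dl * prob mu E - e <= prob mu (D n `&` E).
Proof.
move=> mD mE Ddl Dinv e e0.
apply: contrapT => nnear.
pose bad := [set n | prob mu (D n `&` E) < dl * prob mu E - e].
have PB : ProperFilter (within bad \oo).
  split; last exact: within_filter.
  move=> /= H; apply: nnear; move: H; rewrite /within /=; apply: filterS => n nb.
  by rewrite leNgt; apply/negP => /nb.
have [U [UU BU]] := ultraFilterLemma PB.
have PU : ProperFilter U by apply: ultra_proper.
have ooU (P : set nat) : (\forall n \near \oo, P n) -> U P.
  by move=> oP; apply: BU; rewrite /within /=; apply: filterS oP.
have badU : U bad by apply: BU; rewrite /within /=; exact: nearW.
have mDI n A : measurable A -> measurable (D n `&` A).
  by move=> mA; exact: measurableI.
have ex A : exists l : R, measurable A -> prob mu (D n `&` A) @[n --> U] --> l.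
  have [mA|nA] := pselect (measurable A); last by exists 0.
  have [|l] := @ultra_bounded_cvg U (fun n => prob mu (D n `&` A)) UU.
    by move=> n; rewrite prob_ge0 prob_le1 //; exact: mDI.
  by exists l.
pose nu A := sval (cid (ex A)).
have nuP A (mA : measurable A) : prob mu (D n `&` A) @[n --> U] --> nu A.
  exact: (svalP (cid (ex A))).
have nu_ge0 A : measurable A -> 0 <= nu A.
  move=> mA; apply: (cvgr_to_ge (nuP A mA)).
  by apply: nearW => n; exact: prob_ge0.
have nu_le A : measurable A -> nu A <= prob mu A.
  move=> mA; apply: (cvgr_to_le (nuP A mA)).
  by apply: nearW => n; exact: (prob_le mu (mDI n A mA) mA (@subIsetr _ _ _)).
have nuU A B : measurable A -> measurable B -> A `&` B = set0 ->
    nu (A `|` B) = nu A + nu B.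
  move=> mA mB AB; have mAB := measurableU _ _ mA mB.
  apply: (cvg_unique (F := prob mu (D n `&` (A `|` B)) @[n --> U])
    (@Rhausdorff R)); first exact: nuP.
  have -> : (fun n => prob mu (D n `&` (A `|` B))) =
            (fun n => prob mu (D n `&` A) + prob mu (D n `&` B)).
    apply/funext => n; rewrite setIUr probU //; [exact: mDI|exact: mDI|].
    by rewrite setIACA AB setI0.
  by apply: cvgD; exact: nuP.
have nu_pre A : measurable A -> nu (T @^-1` A) = nu A.
  move=> mA; have mTA := measurable_preimage mT mA.
  apply: (cvg_unique (F := prob mu (D n `&` (T @^-1` A)) @[n --> U])
    (@Rhausdorff R)); first exact: nuP.
  apply/cvgrPdist_le => eps eps0.
  have /cvgrPdist_le/(_ (eps / 2)) := nuP A mA; have eps2 : 0 < eps / 2 by lra.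
  move=> /(_ eps2) H1.
  have /cvgrPdist_le/(_ _ eps2)/ooU H2 := Dinv.
  apply: filterS2 H1 H2 => n.
  move=> H1; rewrite sub0r normrN (ger0_norm (prob_ge0 _ _)) => H2.
  set TD := T @^-1` D n.
  have mTD : measurable TD by exact: measurable_preimage.
  have e1 : prob mu (D n `&` A) = prob mu (TD `&` T @^-1` A).
    exact: (esym (prob_preimage muT (mDI n A mA))).
  have e2 : prob mu (D n `\` TD) = prob mu (TD `\` D n).
    have := prob_preimage muT (mD n).
    rewrite (prob_setD mu (mD n) mTD) (prob_setD mu mTD (mD n)).
    by rewrite [TD `&` _]setIC => /addIr.
  have h1 : prob mu (D n `&` T @^-1` A) <=
      prob mu (TD `&` T @^-1` A) + prob mu (D n `\` TD).
    apply: prob_le_add; [exact: measurableI|exact: measurableD|exact: mDI|].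
    by move=> x [Dx Ax]; have [TDx|TDx] := pselect (TD x); [left|right].
  have h2 : prob mu (TD `&` T @^-1` A) <=
      prob mu (D n `&` T @^-1` A) + prob mu (TD `\` D n).
    apply: prob_le_add; [exact: measurableI|exact: measurableD|exact: measurableI|].
    by move=> x [Dx Ax]; have [TDx|TDx] := pselect (D n x); [left|right].
  move: H1; rewrite e1 !ler_norml => /andP[H3 H4]; apply/andP; lra.
pose c := nu setT.
pose sg A := nu A - c * prob mu A.
have c_ge0 : 0 <= c by exact: nu_ge0.
have dlc : dl <= c.
  apply: (cvgr_to_ge (nuP _ measurableT)).
  by apply: nearW => n; rewrite setIT.
have nuE : nu E <= dl * prob mu E - e.
  apply: (cvgr_to_le (nuP E mE)).
  by apply: filterS badU => n /ltW.
have : 0 <= sg E.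
  apply: (@invariant_dominated_ge0 _ _ _ mu T mT ergT sg (1 + c)) => //.
  - move=> A B mA mB AB; rewrite /sg nuU // probU //; lra.
  - move=> A mA; rewrite /sg ler_norml mulrDl mul1r.
    have := nu_ge0 A mA; have := nu_le A mA; have := mulr_ge0 c_ge0 (prob_ge0 mu A).
    by have := prob_ge0 mu A; move=> h1 h2 h3 h4; apply/andP; split; lra.
  - by move=> A mA; rewrite /sg nu_pre // prob_preimage.
  - by rewrite /sg /c probT; lra.
rewrite /sg; have := ler_wpM2r (prob_ge0 mu E) dlc; lra.
Qed.

End AlmostInvariant.

(** * Visits to a set, and small sets *)

Section FiniteUnions.
Context {d} {S : measurableType d} {R : realType} (mu : probability S R).

Lemma prob_bigsetU_le (I : eqType) (s : seq I) (F : I -> set S) (a : R) :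
  (forall t, t \in s -> measurable (F t)) ->
  (forall t, t \in s -> prob mu (F t) <= a) ->
  prob mu (\big[setU/set0]_(t <- s) F t) <= (size s)%:R * a.
Proof.
elim: s => [|t s IH] mF Fa; first by rewrite big_nil prob0 mul0r.
have mFs u : u \in s -> measurable (F u).
  by move=> us; apply: mF; rewrite in_cons us orbT.
rewrite big_cons /= -add1n natrD mulrDl mul1r.
have mFt : measurable (F t) by apply: mF; rewrite in_cons eqxx.
apply: le_trans (probU_le mu mFt _) _.
  by rewrite big_seq; apply: bigsetU_measurable.
apply: lerD; first by apply: Fa; rewrite in_cons eqxx.
by apply: IH => // u us; apply: Fa; rewrite in_cons us orbT.
Qed.

Lemma prob_bigsetU_disjoint n (F : nat -> set S) (z : R) :
  (forall i, measurable (F i)) -> (forall i, prob mu (F i) = z) ->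
  (forall i j, (i < j < n)%N -> F i `&` F j = set0) ->
  prob mu (\big[setU/set0]_(i < n) F i) = n%:R * z.
Proof.
move=> mF Fz; elim: n => [|n IH] tF; first by rewrite big_ord0 prob0 mul0r.
rewrite big_ord_recr /= probU //.
- rewrite IH; first by rewrite Fz -addn1 natrD mulrDl mul1r.
  by move=> i j /andP[ij jn]; apply: tF; rewrite ij ltnW.
- exact: bigsetU_measurable.
- apply/seteqP; split=> x // [].
  rewrite -bigcup_mkord => -[i /= iltn Fix] Fnx.
  have Fin0 : F i `&` F n = set0 by apply: tF; rewrite iltn ltnSn.
  by have : (F i `&` F n) x by []; rewrite Fin0.
Qed.

End FiniteUnions.

Section Sweep.
Context {d} {S : measurableType d} {R : realType} (mu : probability S R).
Context (T : S -> S) (mT : measurable_fun setT T).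
Hypothesis muT : invariant_measure mu T.
Context (G : set S) (mG : measurable G).

Definition sweep l : set S := [set x | exists2 j, (j < l)%N & G (iter j T x)].

Lemma measurable_sweep l : measurable (sweep l).
Proof.
rewrite (_ : sweep l = \bigcup_(j in `I_l) (iter j T @^-1` G)).
  by apply: bigcup_measurable => j _; exact: measurable_iter_preimage.
by apply/seteqP; split=> x [j jl Gj]; exists j.
Qed.

Lemma prob_sweep_mul B l : prob mu (sweep (B * l)) <= B%:R * prob mu (sweep l).
Proof.
elim: B => [|B IH].
  rewrite mul0n mul0r (_ : sweep 0 = set0) ?prob0 //.
  by apply/seteqP; split=> x // [].
have mpre := measurable_iter_preimage mT (B * l) (measurable_sweep l).
rewrite -addn1 natrD mulrDl mul1r.
rewrite -(prob_iter_preimage mT muT (B * l) (measurable_sweep l)).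
apply: (@le_trans _ _ (prob mu (sweep (B * l)) +
    prob mu (iter (B * l) T @^-1` sweep l))).
  apply: prob_le_add => //; [exact: measurable_sweep|exact: measurable_sweep|].
  move=> x [j jl Gj]; have [jB|Bj] := ltnP j (B * l); first by left; exists j.
  right; exists (j - B * l)%N; first by rewrite mulnDl mul1n in jl; lia.
  by rewrite -iterD subnK.
by rewrite lerD2r (prob_iter_preimage mT muT (B * l) (measurable_sweep l)).
Qed.

(** A point that is about to enter the sweep has its first visit to [G] exactly
    [l] steps ahead, so the sets of points that do so after [0], ..., [l] steps
    are pairwise disjoint and of equal measure. *)
Lemma prob_sweep_boundary l :
  prob mu (T @^-1` sweep l `\` sweep l) <= l.+1%:R^-1.
Proof.
pose Z := iter l T @^-1` G `\` sweep l.
have mZ : measurable Z.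
  apply: measurableD; last exact: measurable_sweep.
  exact: measurable_iter_preimage.
have mTs : measurable (T @^-1` sweep l).
  exact/measurable_preimage/measurable_sweep.
apply: (@le_trans _ _ (prob mu Z)).
  apply: prob_le => //; first by apply: measurableD => //; exact: measurable_sweep.
  move=> x [[j jl Gj] nx]; split=> //=; rewrite -iterSr in Gj.
  have [jl'|lj] := ltnP j.+1 l; first by exfalso; apply: nx; exists j.+1.
  by have <- : j.+1 = l by apply/eqP; rewrite eqn_leq jl lj.
rewrite -[leRHS]mul1r ler_pdivlMr // mulrC.
rewrite -(@prob_bigsetU_disjoint _ _ _ mu l.+1 (fun i => iter i T @^-1` Z)).
- apply: prob_le1; apply: bigsetU_measurable => i _.
  exact: measurable_iter_preimage.
- by move=> i; exact: measurable_iter_preimage.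
- by move=> i; exact: prob_iter_preimage.
- move=> i j /andP[ij jl]; apply/seteqP; split=> x // [[Gi _] [_ ns]].
  apply: ns; exists (l - (j - i))%N; first lia.
  rewrite -iterD; move: Gi; rewrite /= -iterD.
  by have -> : (l + i = l - (j - i) + j)%N by lia.
Qed.

End Sweep.

Section Nonatomic.
Context {d} {S : measurableType d} {R : realType} (mu : probability S R).

(** A set that is not an atom splits into two parts of positive measure, and the
    smaller one has at most half of its measure. *)
Lemma nonatomic_small : nonatomic mu -> forall n,
  exists E, [/\ measurable E, 0 < prob mu E & prob mu E <= 2^-1 ^+ n].
Proof.
move=> na; elim=> [|n [E [mE E0 En]]].
  by exists setT; rewrite probT expr0.
have [F [mF FE F0 FE']] : exists F, [/\ measurable F, F `<=` E,
    prob mu F != 0 & prob mu F != prob mu E].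
  apply: contrapT => nF; apply: (na E); split=> //; first by rewrite probE.
  move=> F mF FE; apply: contrapT => /not_orP[F0 F1]; apply: nF.
  exists F; split=> //; apply/eqP => e; [apply: F0|apply: F1].
    by rewrite probE // e.
  by rewrite !probE // e.
have := prob_setD mu mE mF; rewrite (setIidr FE) => eE.
have F0' : 0 < prob mu F by rewrite lt_neqAle eq_sym F0 prob_ge0.
have D0 : 0 < prob mu (E `\` F).
  rewrite lt_neqAle prob_ge0 andbT eq_sym; apply: contra FE' => /eqP D0.
  by rewrite eE D0 add0r.
have [FD|DF] := lerP (prob mu F) (prob mu (E `\` F)).
  by exists F; split=> //; rewrite exprS; lra.
exists (E `\` F); split=> //; first exact: measurableD.
by rewrite exprS; lra.
Qed.

(** Along the rigidity times, mixing gives [dl * prob mu E <= prob mu E ^+ 2],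
    which fails for sets of positive measure less than [dl]. *)
Lemma partially_rigid_not_mixing (T : S -> S) : nonatomic mu ->
  partially_rigid mu T -> ~ strongly_mixing mu T.
Proof.
move=> na [dl dl0 [t [t0 too rig]]] mix.
have sq E : measurable E -> dl * prob mu E <= prob mu E ^+ 2.
  move=> mE; have [lE _] := cvg_limn_einf_sup (cvg_comp _ _ too (mix E E mE mE)).
  by have := rig E mE; rewrite [limn_einf _]lE -lee_fin expr2 !EFinM -!probE.
have [n ndl] : exists n, 2^-1 ^+ n < dl.
  have := @cvg_expr R 2^-1.
  rewrite ger0_norm ?invr_ge0 // invf_lt1 ?ltr1n // => /(_ isT).
  by move=> /cvgr_lt/(_ dl dl0)[n _ /(_ n (leqnn n)) nd]; exists n.
have [E [mE E0 En]] := nonatomic_small na n.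
have := sq E mE; rewrite expr2 ler_pM2r // => dE.
by have := le_lt_trans (le_trans dE En) ndl; rewrite ltxx.
Qed.

End Nonatomic.

(** * Topology and Borel sets of a subshift *)

Section FullShiftTopology.
Context (A : finType).

Definition cylinder L (x : fullshift A) : set (fullshift A) :=
  [set y | forall i : int, - L%:Z <= i < L%:Z -> y i = x i].

Lemma nbhs_cylinder L (x : fullshift A) : nbhs x (cylinder L x).
Proof.
have nbhs_coord (i : int) : nbhs x [set y : fullshift A | y i = x i].
  have /= H := @proj_continuous int (fun=> discrete_topology A) i x.
  apply: (H [set x i]).
  by rewrite nbhs_principalE; apply/principal_filterP.
have nbhs_interval n : nbhs x [set y : fullshift A | forall k, (k < n)%N ->
    y (k%:Z - L%:Z) = x (k%:Z - L%:Z)].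
  elim: n => [|n IH]; first by apply: filterS filterT => y _ k.
  apply: filterS2 IH (nbhs_coord (n%:Z - L%:Z)) => y Hy Hn k.
  by rewrite ltnS leq_eqVlt => /orP[/eqP->|/Hy].
apply: filterS (nbhs_interval (L + L)%N) => y Hy i /andP[iL Li].
have -> : i = (absz (i + L%:Z))%:Z - L%:Z by lia.
by apply: Hy; lia.
Qed.

Lemma nbhs_fullshift (x : fullshift A) V : nbhs x V ->
  exists L, cylinder L x `<=` V.
Proof.
pose F : set_system (fullshift A) := [set V | exists L, cylinder L x `<=` V].
have FF : Filter F.
  split.
  - by exists 0%N.
  - move=> P Q [L LP] [M MQ]; exists (maxn L M) => y Hy.
    by split; [apply: LP|apply: MQ] => i iL; apply: Hy; lia.
  - by move=> P Q PQ [L LP]; exists L; exact: subset_trans PQ.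
suff cF : F --> x by move/cF.
apply/cvg_sup => i W [B [[C oC <-] /= Cx] CW]; exists (absz i).+1 => y Hy.
apply: CW => /=; have -> // : y i = x i.
by apply: Hy; lia.
Qed.

End FullShiftTopology.

Section SubshiftBorel.
Context (A : finType) (X : subshift A).
Implicit Types x y : borel_subshift X.

Definition coord x : fullshift A := \val (x : set_type (points X)).

Lemma coord_inj : injective coord.
Proof. exact: val_inj. Qed.

Lemma coord_in x : points X (coord x).
Proof. exact: set_valP. Qed.

Lemma coordK (u : fullshift A) : points X u -> exists x, coord x = u.
Proof. by move=> Xu; exists (exist _ u (mem_set Xu)). Qed.

Definition agree L x y :=
  forall i : int, - L%:Z <= i < L%:Z -> coord x i = coord y i.

Definition window_set L (E : set (borel_subshift X)) :=
  forall x y, agree L x y -> E x -> E y.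

(** The topology of [X] in terms of coordinates: the only access to the product
    and subspace topologies in what follows. *)
Lemma open_agree (O : set (borel_subshift X)) :
  @open (subshift_space X) O <->
  (forall x, O x -> exists L, forall y, agree L x y -> O y).
Proof.
split=> [[V oV <-] x Vx|H].
  have : nbhs (coord x) V by rewrite nbhsE; exists V.
  move=> /nbhs_fullshift[L LV]; exists L => y xy.
  by apply: LV => i iL; exact: esym (xy i iL).
pose V := \bigcup_(xL in [set xL : borel_subshift X * nat |
   O xL.1 /\ forall y, agree xL.2 xL.1 y -> O y]) (cylinder xL.2 (coord xL.1))^°.
exists V.
  by apply: bigcup_open => xL _; exact: open_interior.
apply/seteqP; split=> x.
  move=> [[y L] [/= Oy HO]] /interior_subset /= Hx; apply: HO => i iL.
  by rewrite -(Hx i iL).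
move=> Ox; have [L HL] := H x Ox; exists (x, L) => //.
exact: nbhs_cylinder.
Qed.

Lemma measurable_open_agree (O : set (borel_subshift X)) :
  (forall x, O x -> exists L, forall y, agree L x y -> O y) -> measurable O.
Proof. by move=> /open_agree oO; exact: sub_sigma_algebra. Qed.

Lemma window_set_measurable L (E : set (borel_subshift X)) :
  window_set L E -> measurable E.
Proof.
move=> wE; apply: measurable_open_agree => x Ex; exists L => y xy.
exact: wE xy Ex.
Qed.

Lemma borel_ind (P : set (borel_subshift X) -> Prop) :
  (forall O, (forall x, O x -> exists L, forall y, agree L x y -> O y) -> P O) ->
  (forall E, P E -> P (~` E)) ->
  (forall F : nat -> set (borel_subshift X), (forall n, P (F n)) ->
    P (\bigcup_n F n)) ->
  forall E, measurable E -> P E.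
Proof.
move=> Popen PC PU E mE; apply: mE; split; last first.
  by move=> O /open_agree; exact: Popen.
split=> //.
- by apply: Popen.
- by move=> B PB; rewrite setTD; exact: PC.
Qed.

Local Notation T := (@subshift_map A X).

Lemma coord_shift x i : coord (T x) i = coord x (i + 1).
Proof. by []. Qed.

Lemma coord_iter n x i : coord (iter n T x) i = coord x (i + n%:Z).
Proof.
elim: n i => [|n IH] i; first by rewrite addr0.
by rewrite iterS coord_shift IH; congr (coord x _); lia.
Qed.

Lemma subshift_map_inj : injective T.
Proof.
move=> x y e; apply: coord_inj; apply/funext => i.
by have := congr1 (fun z => coord z (i - 1)) e; rewrite !coord_shift subrK.
Qed.

Lemma subshift_map_surj y : exists x, T x = y.
Proof.
have := coord_in y; rewrite -[X in X _]subshift_invariant => -[u Xu uy].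
have [x xu] := coordK Xu; exists x; apply: coord_inj; rewrite -uy -xu.
by apply/funext => i.
Qed.

Lemma measurable_subshift_map : measurable_fun setT T.
Proof.
move=> _ E mE; rewrite setTI; move: E mE; apply: borel_ind.
- move=> O oO; apply: measurable_open_agree => x /= /oO[L HL]; exists L.+1 => y xy.
  by apply: HL => i iL; rewrite !coord_shift; apply: xy; lia.
- by move=> E mE; exact: measurableC.
- by move=> F mF; rewrite preimage_bigcup; exact: bigcup_measurable.
Qed.

Lemma measurable_image_subshift_map E : measurable E -> measurable (T @` E).
Proof.
move: E; apply: borel_ind.
- move=> O oO; apply: measurable_open_agree => _ [x /oO[L HL] <-].
  exists L.+1 => y; have [z <-] := subshift_map_surj y => xz.
  exists z => //; apply: HL => i iL; have := xz (i - 1).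
  by rewrite !coord_shift subrK; apply; lia.
- move=> E mE; rewrite (_ : T @` (~` E) = ~` (T @` E)); first exact: measurableC.
  apply/seteqP; split=> y.
    by move=> [x nEx <-] [z Ez /subshift_map_inj zx]; apply: nEx; rewrite -zx.
  have [x <-] := subshift_map_surj y => nE; exists x => // Ex.
  by apply: nE; exists x.
- by move=> F mF; rewrite image_bigcup; exact: bigcup_measurable.
Qed.

Lemma measurable_image_iter n E : measurable E -> measurable (iter n T @` E).
Proof.
move=> mE; elim: n => [|n IH]; first by rewrite image_id.
rewrite (_ : _ @` E = T @` (iter n T @` E)); last by rewrite image_comp.
exact: measurable_image_subshift_map.
Qed.

Lemma iter_subshift_map_inj n : injective (iter n T).
Proof. by elim: n => // n IH x y /subshift_map_inj /IH. Qed.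

Context {R : realType} (mu : probability (borel_subshift X) R).
Hypothesis muT : invariant_measure mu T.

(** The shift is injective with measurable images, so the forward images of the
    definition of rigidity can be traded for preimages. *)
Lemma prob_image_iter n E : measurable E ->
  mu ((iter n T @` E) `&` E) = (prob mu (E `&` (iter n T @^-1` E)))%:E.
Proof.
move=> mE; have mI := measurable_image_iter n mE.
rewrite probE; last exact: measurableI.
rewrite -(prob_iter_preimage measurable_subshift_map muT n); last exact: measurableI.
congr (_%:E); congr prob; rewrite preimage_setI; congr (_ `&` _).
apply/seteqP; split=> [x [y Ey /iter_subshift_map_inj <-] //|x Ex].
by exists x.
Qed.

(** Open sets are increasing unions of sets that depend on finitely many
    coordinates, and the sets that can be approximated form a sigma-algebra. *)
Lemma window_approximation E (e : R) : measurable E -> 0 < e ->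
  exists L F, window_set L F /\ prob mu (E `\` F) + prob mu (F `\` E) <= e.
Proof.
move=> mE e0.
suff : measurable E /\ forall e : R, 0 < e -> exists L F, window_set L F /\
    prob mu (E `\` F) + prob mu (F `\` E) <= e by move=> [_ /(_ e e0)].
move: E mE {e e0}; apply: borel_ind.
- move=> O oO; have mO := measurable_open_agree oO; split=> // e e0.
  pose F L := [set x | forall y, agree L x y -> O y].
  have wF L : window_set L (F L).
    by move=> x y xy Fx z yz; apply: Fx => i iL; rewrite xy // yz.
  have FO L : F L `<=` O by move=> x; apply.
  have mF L := window_set_measurable (wF L).
  have OE : O = \bigcup_L F L.
    apply/seteqP; split=> x; last by move=> [L _ /FO].
    by move=> /oO[L HL]; exists L.
  have /cvgrPdist_le/(_ e e0)[L _ /(_ L (leqnn L)) HL] :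
      prob mu (F L) @[L --> \oo] --> prob mu O.
    rewrite OE; apply: prob_nondecreasing_cvg => // m n mn.
    apply/subsetPset => x Fx y xy; apply: Fx => i im; apply: xy; lia.
  exists L, (F L); split=> //.
  have -> : F L `\` O = set0.
    by apply/seteqP; split=> // x [/FO].
  rewrite prob0 addr0; apply: le_trans HL.
  rewrite (prob_setD mu mO (mF L)) (setIidr (FO L)) addrK.
  exact: ler_norm.
- move=> E [mE H]; split; first exact: measurableC.
  move=> e /H[L [F [wF HF]]]; exists L, (~` F); split.
    by move=> x y xy nF Fy; apply: nF; apply: wF Fy => i iL; rewrite xy.
  by rewrite !setDE !setCK setIC addrC [X in prob mu X + _]setIC -!setDE.
- move=> E H; have mE n := (H n).1; split; first exact: bigcup_measurable.
  move=> e e0.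
  pose G n := \big[setU/set0]_(i < n) E i.
  have GE : \bigcup_n E n = \bigcup_n G n by exact: bigcup_partial_unions.
  have mG n : measurable (G n) by exact: bigsetU_measurable.
  have wG n (e' : R) : 0 < e' -> exists L F, window_set L F /\
      prob mu (G n `\` F) + prob mu (F `\` G n) <= e'.
    elim: n e' => [|n IH] e' e'0.
      exists 0%N, set0; split=> //.
      by rewrite /G big_ord0 setD0 prob0 addr0 ltW.
    have e2 : 0 < e' / 2 by lra.
    have [L1 [F1 [w1 H1]]] := IH _ e2.
    have [L2 [F2 [w2 H2]]] := (H n).2 _ e2.
    have m1 := window_set_measurable w1; have m2 := window_set_measurable w2.
    have wU : window_set (maxn L1 L2) (F1 `|` F2).
      move=> x y xy [F1x|F2x]; [left; apply: w1 F1x|right; apply: w2 F2x];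
        move=> i iL; apply: xy; lia.
    have mU := window_set_measurable wU.
    exists (maxn L1 L2), (F1 `|` F2); split=> //.
    have mGn := mG n; have mEn := mE n.
    have GS : G n.+1 = G n `|` E n by rewrite /G big_ord_recr.
    have h1 : prob mu (G n.+1 `\` (F1 `|` F2)) <=
        prob mu (G n `\` F1) + prob mu (E n `\` F2).
      apply: prob_le_add; try exact: measurableD.
      rewrite GS => x [[Gx|Ex] nF]; [left|right]; split=> // Fx.
        by apply: nF; left.
      by apply: nF; right.
    have h2 : prob mu ((F1 `|` F2) `\` G n.+1) <=
        prob mu (F1 `\` G n) + prob mu (F2 `\` E n).
      apply: prob_le_add; try exact: measurableD.
      rewrite GS => x [[Gx|Ex] nF]; [left|right]; split=> // Fx.
        by apply: nF; left.
      by apply: nF; right.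
    lra.
  have mU : measurable (\bigcup_n E n) by exact: bigcup_measurable.
  have e2 : 0 < e / 2 by lra.
  have /cvgrPdist_le/(_ _ e2)[n _ /(_ n (leqnn n)) Hn] :
      prob mu (G n) @[n --> \oo] --> prob mu (\bigcup_n E n).
    rewrite GE; apply: prob_nondecreasing_cvg => // m n mn.
    by apply/subsetPset; exact: subset_bigsetU.
  have GU : G n `<=` \bigcup_n E n by rewrite GE => x Gx; exists n.
  have {}Hn : prob mu (\bigcup_n E n `\` G n) <= e / 2.
    apply: le_trans Hn; rewrite (prob_setD mu mU (mG n)) (setIidr GU) addrK.
    exact: ler_norm.
  have [L [F [wF HF]]] := wG n _ e2; exists L, F; split=> //.
  have mF := window_set_measurable wF.
  have h1 : prob mu (\bigcup_n E n `\` F) <=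
      prob mu (\bigcup_n E n `\` G n) + prob mu (G n `\` F).
    apply: prob_le_add; try exact: measurableD.
    by move=> x [Ux nF]; have [Gx|nG] := pselect (G n x); [right|left].
  have h2 : prob mu (F `\` \bigcup_n E n) <= prob mu (F `\` G n).
    apply: prob_le; [exact: measurableD|exact: measurableD|].
    by move=> x [Fx nE]; split=> // /GU.
  lra.
Qed.

End SubshiftBorel.

(** * Partial rigidity *)

Section Limits.
Context {R : realType}.

Lemma limn_einf_lty (u : nat -> R) :
  (limn_einf (fun n => (u n)%:E) < +oo)%E ->
  exists C : nat, forall n, exists2 q, (n <= q)%N & u q <= C%:R.
Proof.
move=> ul.
have [C lC] : exists C : nat, (limn_einf (fun n => (u n)%:E) < C%:R%:E)%E.
  case: (limn_einf _) ul => [r _||_] //.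
  - exists (Num.bound `|r|).
    by rewrite lte_fin (le_lt_trans (ler_norm r)) // archi_boundP.
  - by exists 0%N; rewrite ltNyr.
exists C => n.
have : (einfs (fun n => (u n)%:E) n < C%:R%:E)%E.
  apply: le_lt_trans lC; rewrite limn_einf_lim.
  rewrite (cvg_lim _ (@cvg_einfs_sup _ _)) //.
  by apply: ereal_sup_ubound; exists n.
move=> /ereal_inf_lt[_ [q /= nq <-]]; rewrite lte_fin => uC.
by exists q => //; exact: ltW.
Qed.

Lemma limn_einf_ge (u : nat -> R) (a : R) :
  (forall e, 0 < e -> \forall n \near \oo, a - e <= u n) ->
  (a%:E <= limn_einf (fun n => (u n)%:E))%E.
Proof.
move=> H; apply/lee_addgt0Pr => e e0.
have [N _ HN] := H e e0.
rewrite -leeBlDr // -EFinB limn_einf_lim (cvg_lim _ (@cvg_einfs_sup _ _)) //.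
apply: (@le_trans _ _ (einfs (fun n => (u n)%:E) N)); last first.
  by apply: ereal_sup_ubound; exists N.
by apply: le_ereal_inf_tmp => _ [q /= Nq <-]; rewrite lee_fin; exact: HN.
Qed.

End Limits.

Section Tails.
Context (A : finType) (X : subshift A).

Definition tails : set (nat -> A) :=
  [set u | exists x i, points X x /\ u = (fun k => x (i + k%:Z))].

Lemma tails_drop u i : tails u -> tails (fun k => u (i + k)%N).
Proof.
move=> [x [j [Xx ->]]]; exists x, (j + i%:Z); split=> //.
by apply/funext => k; congr x; lia.
Qed.

(** The words of [X] are the prefixes of its one-sided tails. *)
Lemma complexity_lang q : complexity X q = #|lang tails q|.
Proof.
apply: eq_card => w; rewrite !inE; apply/idP/idP.
  move/set_mem => [x [i [n [Xx e]]]]; apply/asboolP.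
  exists (fun k => x (i + k%:Z)); first by exists x, i.
  have nq : n = q by rewrite -(size_tuple w) e size_mkseq.
  apply: val_inj; rewrite /= [RHS]e nq /word /mkseq -val_enum_ord -map_comp.
  by apply: eq_map => k.
move/asboolP => [_ [x [i [Xx ->]]] <-]; apply/mem_set.
exists x, i, q; split=> //=; rewrite /word /mkseq -val_enum_ord -map_comp.
by apply: eq_map => k.
Qed.

End Tails.

Section PartialRigidity.
Context (A : finType) (X : subshift A) {R : realType}.
Context (mu : probability (borel_subshift X) R).
Local Notation T := (@subshift_map A X).
Hypotheses (muT : invariant_measure mu T) (ergT : ergodic mu T).
Local Notation mT := (@measurable_subshift_map A X).

Definition repeats (a b : int) (t : nat) : set (borel_subshift X) :=
  [set x | forall i : int, a <= i < b -> coord x i = coord x (i + t%:Z)].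

Lemma measurable_repeats a b t : measurable (repeats a b t).
Proof.
apply: (@window_set_measurable _ _ (absz a + absz b + t)) => x y xy Hx i iab.
by rewrite -!xy; [exact: Hx|lia|lia].
Qed.

Definition periodic_points t : set (borel_subshift X) :=
  [set x | forall i : int, coord x i = coord x (i + t%:Z)].

Lemma periodic_pointsE t :
  periodic_points t = \bigcap_L repeats (- L%:Z) L%:Z t.
Proof.
apply/seteqP; split=> x Hx; first by move=> L _ i _; exact: Hx.
by move=> i; apply: (Hx (absz i).+1) => //; lia.
Qed.

Lemma measurable_periodic t : measurable (periodic_points t).
Proof.
rewrite periodic_pointsE; apply: bigcapT_measurable => L.
exact: measurable_repeats.
Qed.

Lemma prob_repeats_cvg t :
  prob mu (repeats (- L%:Z) L%:Z t) @[L --> \oo] --> prob mu (periodic_points t).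
Proof.
rewrite periodic_pointsE; apply: prob_nonincreasing_cvg.
  by move=> L; exact: measurable_repeats.
by move=> m n mn; apply/subsetPset => x Hx i im; apply: Hx; lia.
Qed.

Lemma prob_periodic_01 t :
  prob mu (periodic_points t) = 0 \/ prob mu (periodic_points t) = 1.
Proof.
apply: (prob_ergodic ergT (measurable_periodic t)).
apply/seteqP; split=> x Hx i /=.
  by have := Hx (i - 1); rewrite !coord_shift subrK [i - 1 + _]addrAC subrK.
by rewrite !coord_shift [i + _ + 1]addrAC; exact: Hx.
Qed.

Lemma iter_periodic t n x : periodic_points t x -> iter (t * n) T x = x.
Proof.
move=> Hx; apply: coord_inj; apply/funext => i; rewrite coord_iter.
elim: n => [|n IH]; first by rewrite muln0 addr0.
rewrite -[RHS]IH [RHS]Hx; congr (coord x _); lia.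
Qed.

(** The multiples of the period are rigidity times. *)
Lemma periodic_partially_rigid t : (0 < t)%N ->
  prob mu (periodic_points t) = 1 -> partially_rigid mu T.
Proof.
move=> t0 P1; exists 1 => //; exists (fun n => t * n.+1)%N; split.
- by move=> n; rewrite muln_gt0 t0.
- by apply/cvgnyPge => M; exists M => // n /= Mn; nia.
move=> E mE; rewrite mul1e.
under [X in limn_einf X]eq_fun do rewrite (prob_image_iter muT _ mE).
rewrite probE //; apply: limn_einf_ge => e e0; apply: nearW => n.
apply: (@le_trans _ _ (prob mu E)); first by rewrite gerBl ltW.
have mP := measurable_periodic t.
rewrite (prob_setD mu mE mP).
have -> : prob mu (E `\` periodic_points t) = 0.
  apply/eqP; rewrite eq_le prob_ge0 andbT.
  apply: (@le_trans _ _ (prob mu (~` periodic_points t))).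
    by apply: prob_le; [exact: measurableD|exact: measurableC|exact: subIsetr].
  by rewrite prob_setC // P1 subrr.
rewrite add0r; apply: prob_le; first exact: measurableI.
  by apply: measurableI => //; exact: (measurable_iter_preimage mT).
by move=> x [Ex Px]; split=> //=; rewrite iter_periodic.
Qed.

Hypothesis aperiodic : forall t, (0 < t)%N -> prob mu (periodic_points t) = 0.

Definition right_periodic a t : set (borel_subshift X) :=
  [set x | forall k, coord x (a + k)%N%:Z = coord x (a + k + t)%N%:Z].

Lemma measurable_right_periodic a t : measurable (right_periodic a t).
Proof.
rewrite (_ : right_periodic a t = \bigcap_k repeats a%:Z (a + k)%N%:Z t).
  by apply: bigcapT_measurable => L; exact: measurable_repeats.
apply/seteqP; split=> x Hx.
  move=> k _ i iak; have := Hx (absz (i - a%:Z)%R).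
  have -> : (a + absz (i - a%:Z)%R)%N%:Z = i by lia.
  by move=> ->; congr (coord x _); lia.
move=> k; rewrite (Hx k.+1 I); first by congr (coord x _); lia.
lia.
Qed.

(** For every [L] a right periodic point repeats on the window of radius [L]
    around any position beyond [a + L]; by invariance this has the
    same probability around the origin, and the limit in [L] is the
    probability of the points of period [t]. *)
Lemma prob_right_periodic a t : (0 < t)%N -> prob mu (right_periodic a t) = 0.
Proof.
move=> t0; apply/eqP; rewrite eq_le prob_ge0 andbT.
have mQ := measurable_right_periodic a t.
rewrite -(aperiodic t0); apply: (cvgr_to_ge (prob_repeats_cvg (t := t))).
apply: nearW => L; have mW := measurable_repeats (- L%:Z) L%:Z t.
rewrite -(prob_iter_preimage mT muT (a + L) mW).
apply: prob_le => //; first exact: (measurable_iter_preimage mT).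
move=> x Hx i iL; rewrite !coord_iter.
have := Hx (absz (i + L%:Z)%R).
have -> : (a + absz (i + L%:Z)%R)%N%:Z = i + (a + L)%N%:Z by lia.
by move=> ->; congr (coord x _); lia.
Qed.

Lemma eventually_periodic_null : exists N, [/\ measurable N, prob mu N = 0 &
  forall x, eventually_periodic (fun k => coord x k%:Z) -> N x].
Proof.
pose N := \bigcup_a \bigcup_t right_periodic a t.+1.
have mN : measurable N.
  by do 2 (apply: bigcup_measurable => ? _); exact: measurable_right_periodic.
exists N; split=> //.
  have [B [mB B0 NB]] : mu.-negligible N.
    do 2 (apply: negligible_bigcup => ?); eexists; split; last exact: subset_refl.
      exact: measurable_right_periodic.
    exact: etrans (probE mu (measurable_right_periodic _ _))
      (congr1 EFin (prob_right_periodic _ (ltn0Sn _))).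
  apply/eqP; rewrite eq_le prob_ge0 andbT (le_trans (prob_le mu mN mB NB)) //.
  by rewrite /prob B0.
move=> x [a [t [t0 H]]]; exists a => //; exists t.-1 => //.
by rewrite prednK.
Qed.

(** Outside a null set every point sees a repetition of length [r], with one of
    boundedly many return times, within a time proportional to [r].  By
    pigeonhole a single return time [t] serves a set of points of probability
    bounded below; this survives when the waiting time is cut from [B * l] to
    [l], at the cost of a factor [B].  A repetition of length [3 * l] that starts
    between [l] and [2 * l] places before the origin covers the window of
    radius [l]. *)
Lemma recurrence_at_scale K : exists2 dl : R, 0 < dl & forall r, (3 <= r)%N ->
  (#|lang (tails X) r.+1| <= #|lang (tails X) r| + K)%N ->
  (#|lang (tails X) r| <= K * r)%N ->
  exists t D, [/\ (0 < t)%N, measurable D, dl <= prob mu D,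
    prob mu (T @^-1` D `\` D) <= (r %/ 3).+1%:R^-1 &
    D `<=` repeats (- (r %/ 3)%:Z) (r %/ 3)%:Z t].
Proof.
pose m := (2 * K).+1; pose M := (m ^ m)%N; pose B := (m * (5 * K + 1) + 3)%N.
have M0 : (0 < M)%N by rewrite expn_gt0.
have B0 : (0 < B)%N by rewrite /B; lia.
(* M bounds the number of return times; one half makes the final bound strict. *)
pose dl : R := (2 * (M%:R * B%:R))^-1.
have dl0 : 0 < dl by rewrite invr_gt0 !mulr_gt0 // ltr0n.
exists dl => // r r3 HK Hr.
have [s [ss s0 Hs]] := bounded_return_times (@tails_drop A X) HK.
pose l := (r %/ 3)%N.
have l0 : (0 < l)%N by rewrite divn_gt0.
have lr : (3 * l <= r < 3 * l + 3)%N.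
  by rewrite /l {2 3}(divn_eq r 3); have := ltn_pmod r (isT : 0 < 3)%N; lia.
(* Aligned so that fewer than l steps of the shift keep the window of radius l
   inside the repetition. *)
pose G t := repeats (- (2 * l)%N%:Z) l%:Z t.
have mG t : measurable (G t) by exact: measurable_repeats.
have [N [mN N0 HN]] := eventually_periodic_null.
have cover x : N x \/ exists2 t, t \in s & sweep T (G t) (B * l) x.
  have Ux : tails X (fun k => coord x k%:Z).
    exists (coord x), 0; split; first exact: coord_in.
    by apply/funext => k; rewrite add0r.
  have [/HN|[t ts [j jm Hj]]] := Hs _ Ux; [by left|right].
  exists t => //; exists (j + 2 * l)%N.
    have : (#|lang (tails X) r| <= K * (5 * l))%N.
      by apply: leq_trans Hr _; rewrite leq_mul2l; apply/orP; right; lia.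
    move: jm; rewrite -/m /B; set p := #|_| => jm pl.
    have : (m * p.+1 <= m * (K * (5 * l) + l))%N.
      by rewrite leq_mul2l; apply/orP; right; lia.
    nia.
  move=> i il; rewrite !coord_iter.
  have := Hj (absz (i + (2 * l)%N%:Z)%R).
  have -> : (j + absz (i + (2 * l)%N%:Z)%R)%N%:Z = i + (j + 2 * l)%N%:Z by lia.
  have kr : (absz (i + (2 * l)%N%:Z)%R < r)%N by lia.
  by move=> -> //; congr (coord x _); lia.
have [t ts Ht] : exists2 t, t \in s & dl <= prob mu (sweep T (G t) l).
  apply: contrapT => nex.
  have small t : t \in s -> prob mu (sweep T (G t) (B * l)) <= B%:R * dl.
    move=> ts; apply: le_trans (prob_sweep_mul mT muT (mG t) B l) _.
    rewrite ler_wpM2l // leNgt; apply/negP => /ltW dlt; apply: nex.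
    by exists t.
  have msw t : measurable (sweep T (G t) (B * l)) by exact: (measurable_sweep mT).
  have := prob_bigsetU_le (fun t _ => msw t) small.
  set V := \big[setU/set0]_(t <- s) _ => HV.
  have mV : measurable V by exact: bigsetU_measurable.
  have : prob mu setT <= prob mu V + prob mu N.
    apply: prob_le_add => // x _; have [|[t ts xt]] := cover x; [by right|left].
    by rewrite /V -bigcup_seq; exists t.
  rewrite probT N0 addr0 => V1; have := le_trans V1 HV.
  apply/negP; rewrite -ltNge; apply: (@le_lt_trans _ _ (M%:R * (B%:R * dl))).
    by rewrite ler_wpM2r ?ler_nat // mulr_ge0 // ltW.
  rewrite mulrA /dl; set c := M%:R * B%:R.
  have c0 : 0 < c by rewrite mulr_gt0 // ltr0n.
  by rewrite invfM mulrCA mulfV ?mulr1 ?gt_eqF // invf_lt1 // ltr1n.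
exists t, (sweep T (G t) l); split=> //.
- exact: s0.
- exact: (measurable_sweep mT).
- exact: (prob_sweep_boundary mT).
move=> x [j jl Gj] i il; have := Gj (i - j%:Z).
rewrite !coord_iter subrK addrAC subrK; apply; lia.
Qed.

(** At each scale [n] a set [D n] of probability at least [dl] consists of points
    whose central window repeats after [t n] steps, so for [F] depending on the
    window of radius [L <= n], [D n `&` F] lies in the preimage of [F] at time
    [t n].  The [D n] are almost invariant, hence meet every set [E] in
    probability almost at least [dl * prob mu E]. *)
Theorem aperiodic_partially_rigid C :
  (forall n, exists2 q, (n <= q)%N & (#|lang (tails X) q| <= C * q)%N) ->
  partially_rigid mu T.
Proof.
move=> HC; have [dl dl0 Hdl] := recurrence_at_scale (3 * C).
have ex n : exists tD : nat * set (borel_subshift X),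
    [/\ (0 < tD.1)%N, measurable tD.2, dl <= prob mu tD.2,
    prob mu (T @^-1` tD.2 `\` tD.2) <= n.+1%:R^-1 &
    tD.2 `<=` repeats (- n%:Z) n%:Z tD.1].
  have [r [nr rK rC]] := low_complexity_length (HC (3 * n.+1).*2.+2).
  have [|t [D [t0 mD Ddl Db Dr]]] := Hdl r _ rK rC; first lia.
  have nr3 : (n <= r %/ 3)%N by rewrite leq_divRL //; lia.
  exists (t, D); split=> //=.
    by apply: le_trans Db _; rewrite lef_pV2 ?posrE ?ltr0n // ler_nat.
  by move=> x /Dr Hx i ni; apply: Hx; lia.
have [tD HtD] := choice ex.
pose t n := (tD n).1; pose D n := (tD n).2.
have mD n : measurable (D n) by have [] := HtD n.
have Ddl n : dl <= prob mu (D n) by have [] := HtD n.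
have Dr n : D n `<=` repeats (- n%:Z) n%:Z (t n) by have [] := HtD n.
have Dinv : prob mu (T @^-1` D n `\` D n) @[n --> \oo] --> (0 : R).
  apply: (@squeeze_cvgr _ _ _ _ (fun=> 0) (fun n => n.+1%:R^-1)).
  - by apply: nearW => n; rewrite prob_ge0; have [] := HtD n.
  - exact: cvg_cst.
  - exact: cvg_harmonic.
exists dl => //; exists t; split.
- by move=> n; have [] := HtD n.
- apply/cvgnyPge; elim=> [|M IH]; first exact: nearW.
  (* A return time that recurs at all scales would give periodic points. *)
  have neM : \forall n \near \oo, t n != M.
    have [M0|M0] := posnP M.
      by apply: nearW => n; rewrite M0 -lt0n; have [] := HtD n.
    have := cvgr_lt _ (prob_repeats_cvg (t := M)).
    rewrite aperiodic // => /(_ _ _ dl0).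
    apply: filterS => n nM; apply/eqP => tM; move: nM; apply/negP; rewrite -leNgt.
    apply: le_trans (Ddl n) _; apply: prob_le => //; first exact: measurable_repeats.
    by rewrite -tM.
  by apply: filterS2 IH neM => n Mn nM; rewrite ltn_neqAle eq_sym nM.
move=> E mE; rewrite probE // -EFinM.
under [X in limn_einf X]eq_fun do rewrite (prob_image_iter muT _ mE).
apply: limn_einf_ge => e e0.
have e2 : 0 < e / 2 by lra.
have [L [F [wF HF]]] := window_approximation mu mE e2.
have mF := window_set_measurable wF.
have := almost_invariant_equidistributed mT muT ergT mD mE Ddl Dinv e2.
apply: filterS2 (nbhs_infty_ge L) => n /= Ln Hn.
have mEF := measurableD mE mF; have mFE := measurableD mF mE.
have mpre B := @measurable_iter_preimage _ _ _ mT (t n) B.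
have mI : measurable (E `&` iter (t n) T @^-1` E).
  by apply: measurableI => //; exact: mpre.
have : prob mu (D n `&` E) <= prob mu (E `&` iter (t n) T @^-1` E) +
    (prob mu (E `\` F) + prob mu (F `\` E)).
  rewrite -(prob_iter_preimage mT muT (t n) mFE).
  have mU : measurable ((E `\` F) `|` iter (t n) T @^-1` (F `\` E)).
    by apply: measurableU => //; exact: mpre.
  apply: (@le_trans _ _ (prob mu (E `&` iter (t n) T @^-1` E) +
      prob mu ((E `\` F) `|` iter (t n) T @^-1` (F `\` E)))); last first.
    by rewrite lerD2l; apply: probU_le => //; exact: mpre.
  apply: prob_le_add => //; first exact: measurableI.
  move=> x [Dx Ex].
  have [Fx|nF] := pselect (F x); last by right; left.
  have FTx : F (iter (t n) T x).
    apply: wF Fx => i iL; rewrite coord_iter; apply: (Dr n x Dx); lia.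
  by have [ETx|nE] := pselect (E (iter (t n) T x)); [left|right; right].
lra.
Qed.

End PartialRigidity.

Theorem theorem2 (R : realType) (A : finType) (X : subshift A)
    (mu : probability (borel_subshift X) R)
    (complexity_linear :
      (limn_einf (fun q : nat => ((complexity X q)%:R / q%:R : R)%:E) < +oo)%E)
    (mu_invariant : invariant_measure mu (@subshift_map A X))
    (mu_ergodic : ergodic mu (@subshift_map A X)) :
  partially_rigid mu (@subshift_map A X) /\
  (nonatomic mu -> ~ strongly_mixing mu (@subshift_map A X)).
Proof.
suff rigid : partially_rigid mu (@subshift_map A X).
  by split=> // na; exact: partially_rigid_not_mixing.
have [[t t0 P1]|nper] :=
  pselect (exists2 t, (0 < t)%N & prob mu (@periodic_points A X t) = 1).
  exact: periodic_partially_rigid P1.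
have aper t : (0 < t)%N -> prob mu (@periodic_points A X t) = 0.
  move=> t0; have [//|P1] := prob_periodic_01 mu_ergodic t.
  by exfalso; apply: nper; exists t.
have [C HC] := limn_einf_lty complexity_linear.
apply: (aperiodic_partially_rigid mu_invariant mu_ergodic aper (C := C)) => n.
have [q nq pq] := HC n.+1; exists q; first exact: ltnW.
rewrite ler_pdivrMr ?ltr0n in pq; last exact: leq_trans nq.
by rewrite -complexity_lang -(ler_nat R) natrM.
Qed.
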